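(* Let $\mathbb{H}$ be a semifield and let $\mathbb{D}= \mathbb{H}[a_1,\dots,a_n]$ be an affine bipotent semifield extending $\mathbb{H}$. Then there exist elements $b_1,\dots,b_t,c_{t+1},\dots,c_m \in \mathbb{D}^{\ast}=\mathbb{D}\setminus\{0\}$ such that $$\mathbb{D} = \left(\mathbb{H}(b_1,\dots,b_t)\right)[c_{t+1},\dots,c_{m}]=\left(\mathbb{H}[c_{t+1},\dots,c_{m}]\right)(b_1,\dots,b_t),$$ where $\mathbb{H}(b_1,\dots,b_t)$ is a divisibly-free (pure transcendental) semifield extension of $\mathbb{H}$, and $\mathbb{H}[c_{t+1},\dots,c_{m}]$ is an $\mathbb{H}$-torsion semifield extension of $\mathbb{H}$.
   Context: Semirings are commutative; $\mathbb{N}$ denotes the positive integers. A semifield is a semiring in which every nonzero element is multiplicatively invertible; a domain is a multiplicatively cancellative semiring. A semiring is bipotent if $\alpha+\beta\in\{\alpha,\beta\}$ for all $\alpha,\beta$. ''$\mathbb{D}$ extends $\mathbb{H}$'' means $\mathbb{H}$ is a subsemiring of $\mathbb{D}$ (so $\mathbb{H}$ is bipotent if $\mathbb{D}$ is). $\mathbb{H}[a_1,\dots,a_n]=\{f(a_1,\dots,a_n): f\in\mathbb{H}[x_1,\dots,x_n]\}$; $\mathbb{D}$ is affine over $\mathbb{H}$ if it equals $\mathbb{H}[a_1,\dots,a_n]$ for finitely many $a_i\in\mathbb{D}$. $\mathbb{H}(a_1,\dots,a_n)$ denotes the semifield of fractions of $\mathbb{H}[a_1,\dots,a_n]$, i.e.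 the set of all $f(a_1,\dots,a_n)/g(a_1,\dots,a_n)$ with $f,g\in\mathbb{H}[x_1,\dots,x_n]$, $g(a_1,\dots,a_n)\ne 0$. A finite set $\{a_1,\dots,a_n\}\subset\mathbb{D}$ is divisibly dependent over $\mathbb{H}$ if there are distinct monomials $m_1,m_2\in\mathbb{H}[x_1,\dots,x_n]$ with $m_1(a_1,\dots,a_n)=m_2(a_1,\dots,a_n)$; otherwise it is divisibly independent over $\mathbb{H}$. The extension generated by elements $b_1,\dots,b_t$ invertible in $\mathbb{D}$ is divisibly-free (pure transcendental) over $\mathbb{H}$ if $\{b_1,\dots,b_t\}$ is divisibly independent over $\mathbb{H}$. An element $a\in\mathbb{D}$ is $\mathbb{H}$-torsion if $a^k\in\mathbb{H}$ for some $k\in\mathbb{N}$; an extension of $\mathbb{H}$ is $\mathbb{H}$-torsion if all its elements are $\mathbb{H}$-torsion. *)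

(* Defs.v *)
From HB Require Import structures.
From mathcomp Require Import all_boot all_order all_algebra.
From mathcomp Require Import finmap.
From mathcomp Require Import boolp classical_sets.

Set Implicit Arguments.
Unset Strict Implicit.
Unset Printing Implicit Defensive.

Import GRing.Theory.

Local Open Scope classical_set_scope.
Local Open Scope ring_scope.

(* Formal polynomials in n variables over a commutative semiring (the {mpoly} *)
(* of multinomials requires a ring): finitely supported functions from        *)
(* exponent vectors to coefficients.                                          *)
Notation mvpoly D n := {fsfun {ffun 'I_n -> nat} -> D with 0}.

Section SubSemirings.
Variable D : comNzSemiRingType.
Implicit Types (H F : set D).

Definition subsemiring H : Prop := GRing.semiring_closed (mem H).

(* Nontriviality (1 != 0) is built into comNzSemiRingType. *)
Definition semifield H : Prop :=
  subsemiring H /\ (forall x, H x -> x != 0 -> exists2 y, H y & x * y = 1).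

Definition bipotent H : Prop :=
  forall x y, H x -> H y -> x + y = x \/ x + y = y.

Definition semifield_extension H F : Prop :=
  [/\ semifield H, semifield F & H `<=` F].

Definition mveval n (a : 'I_n -> D) (f : mvpoly D n) : D :=
  \sum_(e <- finsupp f) f e * \prod_(i < n) a i ^+ e i.

(* H[x_1, ..., x_n] *)
Definition mvpoly_over n H : set (mvpoly D n) := [set f | forall e, H (f e)].
Arguments mvpoly_over : clear implicits.

(* H[a_1, ..., a_n] *)
Definition adjoin n H (a : 'I_n -> D) : set D :=
  [set mveval a f | f in mvpoly_over n H].

(* H(a_1, ..., a_n), computed inside D: y is the inverse of g(a). *)
Definition adjoin_frac n H (a : 'I_n -> D) : set D :=
  [set x | exists f g y, [/\ mvpoly_over n H f, mvpoly_over n H g,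
     mveval a g != 0, mveval a g * y = 1 & x = mveval a f * y]].

(* A monomial carries an arbitrary nonzero coefficient. *)
Definition monomial_over n H (f : mvpoly D n) : Prop :=
  mvpoly_over n H f /\ #|` finsupp f| = 1%N.

(* Finite sets are given as indexed families; a family with a repetition is   *)
(* dependent, since x_i and x_j are distinct monomials for i != j.            *)
Definition divisibly_dependent n H (a : 'I_n -> D) : Prop :=
  exists m1 m2 : mvpoly D n,
    [/\ monomial_over H m1, monomial_over H m2, m1 <> m2
      & mveval a m1 = mveval a m2].

Definition divisibly_independent n H (a : 'I_n -> D) : Prop :=
  ~ divisibly_dependent H a.

(* The extension of H generated by the b_i is divisibly-free. *)
Definition divisibly_free n H (b : 'I_n -> D) : Prop :=
  (forall i, exists y, b i * y = 1) /\ divisibly_independent H b.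

Definition torsion_elt H (x : D) : Prop := exists2 k, (0 < k)%N & H (x ^+ k).

Definition torsion_over H F : Prop := forall x, F x -> torsion_elt H x.

End SubSemirings.

(* Main.v *)
Require Import Defs.
From HB Require Import structures.
From mathcomp Require Import all_boot all_order all_algebra zify.
From mathcomp Require Import finmap.
From mathcomp Require Import boolp classical_sets.

Set Implicit Arguments.
Unset Strict Implicit.
Unset Printing Implicit Defensive.

Import Order.TTheory GRing.Theory Num.Theory.

Local Open Scope classical_set_scope.
Local Open Scope ring_scope.

(** A bipotent sum equals one of its terms, so a nonzero value of a polynomial
    over [H] is the value of one of its monomials ([mveval_bipotent]). Addition
    thereby disappears and the theorem becomes a statement about the group [D^*]
    of nonzero elements, written additively below. With [a_1, ..., a_n]
    nonzero, [D = H[a_1, ..., a_n]] says that every unit is the sum of an element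
    of [H^*] and a combination of the [a_i] with natural coefficients; an
    extension [H[c]] corresponds in the same way to the natural combinations of
    the [c_j] modulo [H^*] ([units_in_adjoin]), and [H(b)] to the integral
    combinations of the [b_j] modulo [H^*] ([units_in_adjoin_frac]).

    Let [T] be the set of units having a positive multiple in [H^*]. The quotient
    [D^* / T] is finitely generated and torsion-free, hence free: among the finite
    families generating [D^*] modulo [T], one that cannot be shortened satisfies
    no nontrivial relation modulo [T] ([independent_generators]), because
    Euclid's algorithm on the coefficients of such a relation would produce a
    superfluous generator ([drop_generator]). This yields [b_1, ..., b_t],
    independent modulo [T] and a fortiori modulo [H^*], which is divisible
    independence ([divisibly_free_of_independent]).

    Write [a_i = c_i + g_i] with [c_i] in [T] and [g_i] an integral combination of
    the [b_j]. These [c_i] are the required torsion elements: a unit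
    [u = w + sum e_i a_i], with [w] in [H^*] and natural [e_i], is the sum of
    [w + sum e_i c_i] and of an integral combination of the [b_j], which gives
    both descriptions of [D]; if moreover [u] is in [T], independence kills the
    second summand, so that [u = w + sum e_i c_i] lies in [H[c]]. Thus the units of
    [H[c]] are exactly [T]: they form a group, and [H[c]] is a torsion semifield. *)

(** * Generating an abelian group modulo a saturated subgroup *)

Definition int_comb (V : zmodType) t (b : 'I_t -> V) (e : 'I_t -> int) : V :=
  \sum_i b i *~ e i.

Definition subgroup (V : zmodType) (G : set V) : Prop :=
  G 0 /\ forall x y, G x -> G y -> G (x - y).

Lemma subgroup_opp (V : zmodType) (G : set V) x : subgroup G -> G x -> G (- x).
Proof. by case=> G0 GB Gx; rewrite -sub0r; apply: GB. Qed.

Lemma subgroup_add (V : zmodType) (G : set V) x y :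
  subgroup G -> G x -> G y -> G (x + y).
Proof.
by move=> Gsub Gx Gy; rewrite -[y]opprK; apply: (proj2 Gsub) => //; apply: subgroup_opp.
Qed.

Lemma subgroup_mulrz (V : zmodType) (G : set V) x (k : int) :
  subgroup G -> G x -> G (x *~ k).
Proof.
move=> Gsub Gx; have Gnat m : G (x *+ m).
  by elim: m => [|m IH]; [apply: (proj1 Gsub) | rewrite mulrS; apply: subgroup_add].
by case: k => m; [apply: Gnat | apply: subgroup_opp => //; apply: Gnat].
Qed.

Definition saturated (V : zmodType) (T : set V) : Prop :=
  forall x k, (0 < k)%N -> T (x *+ k) -> T x.

(** This is the preimage in [V] of the torsion subgroup of [V / G], so that the
    quotient of [V] by it is torsion-free. *)
Definition isolator (V : zmodType) (G : set V) : set V :=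
  [set x | exists2 k, (0 < k)%N & G (x *+ k)].

Lemma subgroup_isolator (V : zmodType) (G : set V) :
  subgroup G -> subgroup (isolator G).
Proof.
move=> Gsub; split=> [|x y [k k0 Gx] [l l0 Gy]].
  by exists 1%N => //; rewrite mul0rn; apply: (proj1 Gsub).
exists (k * l)%N; first by rewrite muln_gt0 k0.
rewrite mulrnBl {2}mulnC !mulrnA.
apply: (proj2 Gsub); first by rewrite [_ *+ l]pmulrn; apply: subgroup_mulrz.
by rewrite [_ *+ k]pmulrn; apply: subgroup_mulrz.
Qed.

Lemma saturated_isolator (V : zmodType) (G : set V) : saturated (isolator G).
Proof.
move=> x k k0 [l l0 Gx].
by exists (k * l)%N; rewrite ?muln_gt0 ?k0 // mulrnA.
Qed.

Lemma sub_isolator (V : zmodType) (G : set V) : G `<=` isolator G.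
Proof. by move=> x Gx; exists 1%N. Qed.

Definition generate_modulo (V : zmodType) (T : set V) t (b : 'I_t -> V) : Prop :=
  forall x, exists e, T (x - int_comb b e).

Lemma int_combB (V : zmodType) t (b : 'I_t -> V) e f :
  int_comb b e - int_comb b f = int_comb b (fun i => e i - f i).
Proof. by rewrite -sumrB; apply: eq_bigr => i _; rewrite mulrzBr. Qed.

Lemma int_comb0 (V : zmodType) t (b : 'I_t -> V) : int_comb b (fun=> 0) = 0.
Proof. by apply: big1 => i _; rewrite mulr0z. Qed.

Lemma int_comb_lift (V : zmodType) t (b : 'I_t.+1 -> V) i e :
  int_comb b e = b i *~ e i + int_comb (b \o lift i) (e \o lift i).
Proof. exact: bigD1_ord. Qed.

(** The elementary operation of Euclid's algorithm: replacing [b_i] by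
    [b_i + s b_j] is compensated by replacing [e_j] by [e_j - s e_i]. *)
Lemma int_comb_shear (V : zmodType) t (b : 'I_t -> V) (i j : 'I_t) s e :
    i != j ->
  int_comb (fun k => if k == i then b i + b j *~ s else b k)
           (fun k => if k == j then e j - s * e i else e k) = int_comb b e.
Proof.
move=> ij; have ji : j != i by rewrite eq_sym.
rewrite /int_comb (bigD1 i) //= (bigD1 j) //=.
rewrite [in RHS](bigD1 i) //= [in RHS](bigD1 j) //=.
rewrite !eqxx (negPf ij) (negPf ji) mulrzDl mulrzBr -mulrzA.
rewrite -!addrA; congr (_ + _); rewrite addrCA; congr (_ + _).
rewrite addrA addrN add0r; apply: eq_bigr => k /andP[ki kj].
by rewrite (negPf ki) (negPf kj).
Qed.

(** A nontrivial relation is shortened by shears, which subtract a smaller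
    nonzero coefficient from a larger one in absolute value, until it reads
    [k b_i] in [T] with [k <> 0]; saturation then puts [b_i] itself in [T]. *)
Lemma drop_generator (V : zmodType) (T : set V) t (b : 'I_t.+1 -> V)
    (e : 'I_t.+1 -> int) :
    subgroup T -> saturated T -> generate_modulo T b ->
    (exists i, e i != 0) -> T (int_comb b e) ->
  exists b' : 'I_t -> V, generate_modulo T b'.
Proof.
move=> Tsub Tsat.
have [N] := ubnP (\sum_i `|e i|)%N.
elim: N => // N IH in b e *; rewrite ltnS => eN bgen [i ei] Te.
have [/existsP[j /andP[ji ej]]|/existsPn only_i] :=
    boolP [exists j, (j != i) && (e j != 0)]; last first.
  have Tbi : T (b i).
    apply: (Tsat _ `|e i|%N); first by rewrite absz_gt0.
    have bE : int_comb b e = b i *~ e i.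
      rewrite (int_comb_lift _ i) [int_comb _ _]big1 ?addr0 // => k _ /=.
      have := only_i (lift i k); rewrite eq_sym neq_lift negbK => /eqP ->.
      by rewrite mulr0z.
    move: Te; rewrite bE; case: (e i) => k; first by [].
    by move/(subgroup_opp Tsub); rewrite NegzE mulrNz opprK.
  exists (b \o lift i) => x; have [f Tf] := bgen x.
  exists (f \o lift i).
  have -> : x - int_comb (b \o lift i) (f \o lift i)
      = x - int_comb b f + b i *~ f i.
    by rewrite (int_comb_lift _ i) opprD addrA addrAC subrK.
  by apply: subgroup_add => //; apply: subgroup_mulrz.
wlog le_ij : i j ei ej ji / (`|e i| <= `|e j|)%N.
  move=> wl; case: (leqP `|e i|%N `|e j|%N) => [|/ltnW] le; first exact: (wl i j).
  by apply: (wl j i); rewrite // eq_sym.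
rewrite eq_sym in ji.
(* With this sign, [`|e j - s * e i| = `|e j| - `|e i|]. *)
pose s := sgz (e i) * sgz (e j).
pose shear f k : int := if k == j then f j - s * f i else f k.
apply: (IH (fun k => if k == i then b i + b j *~ s else b k) (shear e)).
- apply: leq_trans eN; rewrite (bigD1 j) //= [in X in (_ < X)%N](bigD1 j) //=.
  rewrite (eq_bigr (fun k => `|e k|%N)) => [|k /negPf kj]; last by rewrite /shear kj.
  by rewrite ltn_add2r /shear eqxx /s; case: sgzP ei => //; case: sgzP ej => //; lia.
- move=> x; have [f Tf] := bgen x; exists (shear f).
  by rewrite int_comb_shear.
- by exists i; rewrite /shear (negPf ji).
- by rewrite int_comb_shear.
Qed.

Lemma independent_generators (V : zmodType) (T : set V) n (a : 'I_n -> V) :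
    subgroup T -> saturated T -> generate_modulo T a ->
  exists t (b : 'I_t -> V), generate_modulo T b /\
    forall e, T (int_comb b e) -> forall i, e i = 0.
Proof.
move=> Tsub Tsat; elim: n => [|n IH] in a *; first by exists 0, a; split=> // e _ [].
move=> agen; have [indep|] :=
    pselect (forall e, T (int_comb a e) -> forall i, e i = 0).
  by exists n.+1, a.
move=> /existsNP[e /not_implyP[Te /existsNP[i /eqP ei]]].
have [b bgen] := drop_generator Tsub Tsat agen (ex_intro _ i ei) Te.
exact: IH bgen.
Qed.

(** * The group of units of a semiring *)

(** Carrying the inverse along makes the units of any commutative semiring a
    group without a choice of inverses. The group law, which is the
    multiplication of [D], is written additively so that integral exponents
    become the integral multiples of a [zmodType]. *)
Record unit_pair (D : comNzSemiRingType) := UnitPair {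
  unit_and_inverse : D * D;
  _ : unit_and_inverse.1 * unit_and_inverse.2 == 1
}.

HB.instance Definition _ (D : comNzSemiRingType) :=
  [isSub for @unit_and_inverse D].
HB.instance Definition _ (D : comNzSemiRingType) :=
  [Choice of unit_pair D by <:].

Definition uval (D : comNzSemiRingType) (u : unit_pair D) : D := (val u).1.

Lemma uval_inverse (D : comNzSemiRingType) (u : unit_pair D) :
  uval u * (val u).2 = 1.
Proof. exact/eqP/(valP u). Qed.

Lemma uval_inj (D : comNzSemiRingType) : injective (@uval D).
Proof.
move=> u v uv; have := uval_inverse u; have := uval_inverse v.
move: uv; rewrite /uval => uv; rewrite -uv => uv1 uu1.
apply/val_inj/eqP; rewrite -pair_eqE /pair_eq /= uv eqxx /=; apply/eqP.
by rewrite -[LHS]mul1r -uv1 mulrAC uu1 mul1r.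
Qed.

Lemma unit_pair_mul_proof (D : comNzSemiRingType) (u v : unit_pair D) :
  uval u * uval v * ((val u).2 * (val v).2) == 1.
Proof. by rewrite mulrACA !uval_inverse mulr1. Qed.

Lemma unit_pair_inv_proof (D : comNzSemiRingType) (u : unit_pair D) :
  (val u).2 * (val u).1 == 1.
Proof. by rewrite mulrC; apply: (valP u). Qed.

Lemma unit_pair_one_proof (D : comNzSemiRingType) : (1 : D) * 1 == 1.
Proof. by rewrite mulr1. Qed.

Definition unit_pair_one (D : comNzSemiRingType) :=
  @UnitPair D (1, 1) (unit_pair_one_proof D).
Definition unit_pair_inv (D : comNzSemiRingType) (u : unit_pair D) :=
  @UnitPair D ((val u).2, (val u).1) (unit_pair_inv_proof u).
Definition unit_pair_mul (D : comNzSemiRingType) (u v : unit_pair D) :=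
  @UnitPair D (uval u * uval v, (val u).2 * (val v).2) (unit_pair_mul_proof u v).

Lemma unit_pair_mulA (D : comNzSemiRingType) : associative (@unit_pair_mul D).
Proof. by move=> u v w; apply: uval_inj; rewrite /uval /= mulrA. Qed.
Lemma unit_pair_mulC (D : comNzSemiRingType) : commutative (@unit_pair_mul D).
Proof. by move=> u v; apply: uval_inj; rewrite /uval /= mulrC. Qed.
Lemma unit_pair_mul1 (D : comNzSemiRingType) :
  left_id (unit_pair_one D) (@unit_pair_mul D).
Proof. by move=> u; apply: uval_inj; rewrite /uval /= mul1r. Qed.
Lemma unit_pair_mulV (D : comNzSemiRingType) :
  left_inverse (unit_pair_one D) (@unit_pair_inv D) (@unit_pair_mul D).
Proof. by move=> u; apply: uval_inj; rewrite /uval /= mulrC (eqP (valP u)). Qed.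

HB.instance Definition _ (D : comNzSemiRingType) :=
  GRing.isZmodule.Build (unit_pair D) (@unit_pair_mulA D) (@unit_pair_mulC D)
    (@unit_pair_mul1 D) (@unit_pair_mulV D).

Lemma uval0 (D : comNzSemiRingType) : uval (0 : unit_pair D) = 1.
Proof. by []. Qed.

Lemma uvalD (D : comNzSemiRingType) (u v : unit_pair D) :
  uval (u + v) = uval u * uval v.
Proof. by []. Qed.

Lemma uvalMn (D : comNzSemiRingType) (u : unit_pair D) k :
  uval (u *+ k) = uval u ^+ k.
Proof. by elim: k => [|k IH] //; rewrite mulrS exprS uvalD IH. Qed.

Lemma uval_sum (D : comNzSemiRingType) t (u : 'I_t -> unit_pair D) :
  uval (\sum_i u i) = \prod_i uval (u i).
Proof. by apply: (big_morph _ (@uvalD D)); apply: uval0. Qed.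

Lemma uval_int_comb (D : comNzSemiRingType) t (b : 'I_t -> unit_pair D)
    (e : 'I_t -> nat) :
  uval (int_comb b e) = \prod_i uval (b i) ^+ e i.
Proof. by rewrite uval_sum; apply: eq_bigr => i _; rewrite -pmulrn uvalMn. Qed.

Lemma uval_neq0 (D : comNzSemiRingType) (u : unit_pair D) : uval u != 0.
Proof.
apply/eqP => u0; have /eqP := uval_inverse u.
by rewrite u0 mul0r eq_sym oner_eq0.
Qed.

Lemma semifield_unit (D : comNzSemiRingType) (F : set D) x :
  semifield F -> F x -> x != 0 -> exists u, uval u = x.
Proof.
by case=> _ Finv Fx x0; have [y _ /eqP xy] := Finv x Fx x0; exists (@UnitPair D (x, y) xy).
Qed.

Definition units_in (D : comNzSemiRingType) (F : set D) : set (unit_pair D) :=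
  [set u | F (uval u)].

Lemma semifield0 (D : comNzSemiRingType) (F : set D) : semifield F -> F 0.
Proof. by case=> -[[/set_mem F0 _] _] _. Qed.

Lemma semifield_subgroup (D : comNzSemiRingType) (F : set D) :
  semifield F -> subgroup (units_in F).
Proof.
case=> -[_ [/set_mem F1 FM]] Finv; split=> // u v Fu Fv.
have [y Fy vy] := Finv _ Fv (uval_neq0 v).
have [w yE] : exists w, uval w = y.
  have yv : y * uval v == 1 by rewrite mulrC vy.
  by exists (@UnitPair D (y, uval v) yv).
have -> : - v = w.
  apply/eqP; rewrite eq_sym -addr_eq0; apply/eqP/uval_inj.
  by rewrite uvalD yE mulrC vy.
by rewrite /units_in /= uvalD yE; apply/set_mem/FM; apply: mem_set.
Qed.

(** Bipotency makes any subset closed under addition, so that only the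
    multiplicative structure has to be checked. *)
Lemma semifieldP (D : comNzSemiRingType) (F : set D) :
    semifield [set: D] -> bipotent [set: D] ->
    F 0 -> subgroup (units_in F) -> semifield F.
Proof.
move=> Dsf Dbip F0 [F1 FB].
have FN u : units_in F u -> units_in F (- u).
  by move=> Fu; rewrite -sub0r; apply: FB.
have toU (x : D) : x != 0 -> exists u, uval u = x by exact: (semifield_unit Dsf I).
split=> [|x Fx /toU[u ux]].
  split; split; try exact: mem_set.
    move=> x y /set_mem Fx /set_mem Fy; apply: mem_set.
    by case: (Dbip x y) => // ->.
  move=> x y /set_mem Fx /set_mem Fy; apply: mem_set.
  have [->|/toU[u ux]] := eqVneq x 0; first by rewrite mul0r.
  have [->|/toU[v vy]] := eqVneq y 0; first by rewrite mulr0.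
  move: Fx Fy; rewrite -ux -vy => Fu Fv.
  by rewrite -uvalD -[v]opprK; apply: FB => //; apply: FN.
exists (uval (- u)); first by apply: FN; rewrite /units_in /= ux.
by rewrite -ux -uvalD addrN.
Qed.

(** * Adjunction in a bipotent semifield *)

Definition term_poly (D : comNzSemiRingType) n (h : D) (e : {ffun 'I_n -> nat}) :
    mvpoly D n :=
  [fsfun [fsfun] with e |-> h].

Lemma term_polyE (D : comNzSemiRingType) n (h : D) (e e' : {ffun 'I_n -> nat}) :
  term_poly h e e' = if e' == e then h else 0.
Proof. by rewrite fsfun_withE fsfunE. Qed.

Lemma mveval_supp1 (D : comNzSemiRingType) n (a : 'I_n -> D) (f : mvpoly D n) e :
    (forall e', e' != e -> f e' = 0) ->
  mveval a f = f e * \prod_i a i ^+ e i.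
Proof.
move=> f0; rewrite /mveval; have [es|ens] := boolP (e \in finsupp f).
  rewrite (big_fsetD1 e) //= big1_fset ?addr0 // => e'.
  by rewrite !inE => /andP[/f0 -> _ _]; rewrite mul0r.
rewrite (fsfun_dflt ens) mul0r big1_fset // => e' e's _.
by rewrite f0 ?mul0r //; apply: contraNneq ens => <-.
Qed.

Lemma mveval_term (D : comNzSemiRingType) n (a : 'I_n -> D) h e :
  mveval a (term_poly h e) = h * \prod_i a i ^+ e i.
Proof.
rewrite (@mveval_supp1 _ _ _ _ e) ?term_polyE ?eqxx // => e' /negPf e'e.
by rewrite term_polyE e'e.
Qed.

Lemma mveval_bipotent (D : comNzSemiRingType) n (a : 'I_n -> D) (f : mvpoly D n) :
    bipotent [set: D] -> mveval a f != 0 ->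
  exists e, mveval a f = f e * \prod_i a i ^+ e i.
Proof.
move=> Dbip; pose is_term x := x = 0 \/ exists e, x = f e * \prod_i a i ^+ e i.
suff : is_term (mveval a f) by case=> // ->; rewrite eqxx.
apply: (@big_ind _ is_term) => [|x y tx ty|e _]; first by left.
  by case: (Dbip x y) => // ->.
by right; exists e.
Qed.

Lemma mveval_unit (D : comNzSemiRingType) (F : set D) n (a : 'I_n -> D)
    (f : mvpoly D n) u :
    semifield [set: D] -> bipotent [set: D] ->
    mvpoly_over F f -> mveval a f = uval u ->
  exists w (e : {ffun 'I_n -> nat}),
    units_in F w /\ uval u = uval w * \prod_i a i ^+ e i.
Proof.
move=> Dsf Dbip Ff fu; have [e fE] : exists e, mveval a f = f e * \prod_i a i ^+ e i.
  by apply: mveval_bipotent => //; rewrite fu uval_neq0.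
have fe0 : f e != 0.
  by apply: contra_neq (uval_neq0 u) => f0; rewrite -fu fE f0 mul0r.
have [w wE] := semifield_unit Dsf I fe0.
by exists w, e; split; [rewrite /units_in /= wE; apply: Ff | rewrite -fu fE wE].
Qed.

Lemma adjoin0 (D : comNzSemiRingType) (F : set D) n (a : 'I_n -> D) :
  F 0 -> adjoin F a 0.
Proof.
move=> F0; exists (term_poly 0 [ffun=> 0%N]); last by rewrite mveval_term mul0r.
by move=> e; rewrite term_polyE; case: ifP.
Qed.

(** One monomial carries each nonzero value of a polynomial, hence a single
    coefficient [w] and a single exponent vector [e]. *)
Lemma units_in_adjoin (D : comNzSemiRingType) (F : set D) n
    (a : 'I_n -> unit_pair D) u :
    semifield [set: D] -> bipotent [set: D] -> F 0 ->
  units_in (adjoin F (@uval D \o a)) u <->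
  exists w (e : 'I_n -> nat), units_in F w /\ u = w + int_comb a e.
Proof.
move=> Dsf Dbip F0; split=> [[f Ff fu]|[w [e [Fw ->]]]].
  have [w [e [Fw uE]]] := mveval_unit Dsf Dbip Ff fu.
  by exists w, e; split=> //; apply: uval_inj; rewrite uE uvalD uval_int_comb.
exists (term_poly (uval w) (finfun e)).
  by move=> e'; rewrite term_polyE; case: ifP.
rewrite mveval_term uvalD uval_int_comb; congr (_ * _).
by apply: eq_bigr => i _; rewrite ffunE.
Qed.

Lemma adjoin_frac0 (D : comNzSemiRingType) (F : set D) n (a : 'I_n -> D) :
  F 0 -> F 1 -> adjoin_frac F a 0.
Proof.
move=> F0 F1; exists (term_poly 0 [ffun=> 0%N]), (term_poly 1 [ffun=> 0%N]), 1.
have e0 : \prod_i a i ^+ [ffun=> 0%N] i = 1 by apply: big1 => i _; rewrite ffunE.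
by split; rewrite ?mveval_term ?e0 ?mulr1 ?mul0r ?oner_eq0 // => e;
  rewrite term_polyE; case: ifP.
Qed.

Lemma units_in_adjoin_frac (D : comNzSemiRingType) (F : set D) n
    (a : 'I_n -> unit_pair D) u :
    semifield [set: D] -> bipotent [set: D] -> semifield F ->
  units_in (adjoin_frac F (@uval D \o a)) u <->
  exists w e, units_in F w /\ u = w + int_comb a e.
Proof.
move=> Dsf Dbip Fsf; have F0 := semifield0 Fsf.
have Fgrp := semifield_subgroup Fsf.
split=> [[f [g [y [Ff Fg g0 gy uE]]]]|[w [e [Fw ->]]]].
  have [v vE] := semifield_unit Dsf I g0.
  have yE : y = uval (- v).
    by rewrite -[RHS]mulr1 -gy -vE mulrA -uvalD addNr mul1r.
  have fE : mveval (@uval D \o a) f = uval (u + v).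
    by rewrite uvalD uE yE -mulrA -uvalD addNr mulr1.
  have [w [e [Fw uvE]]] : exists w (e : 'I_n -> nat),
      units_in F w /\ u + v = w + int_comb a e.
    by apply/(units_in_adjoin a) => //; exists f.
  have [w' [e' [Fw' vE']]] : exists w (e : 'I_n -> nat),
      units_in F w /\ v = w + int_comb a e.
    by apply/(units_in_adjoin a) => //; exists g.
  exists (w - w'), (fun i => (e i)%:Z - (e' i)%:Z).
  split; first exact: (proj2 Fgrp).
  by rewrite -int_combB -[LHS](addrK v) uvE {1}vE' opprD addrACA.
(* [ep] and [en] are the positive and negative parts of the exponents. *)
pose ep i : nat := if 0 <= e i then `|e i|%N else 0%N.
pose en i : nat := if 0 <= e i then 0%N else `|e i|%N.
have eE : int_comb a e = int_comb a ep - int_comb a en.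
  rewrite int_combB; congr int_comb; apply/funext => i.
  by rewrite /ep /en; case: ifP; lia.
have inadj v (k : 'I_n -> nat) :
    units_in F v -> adjoin F (@uval D \o a) (uval (v + int_comb a k)).
  by move=> Fv; apply/(units_in_adjoin a) => //; exists v, k.
have [f Ff fE] := inadj w ep Fw.
have [g Fg gE] := inadj 0 en (proj1 Fgrp).
exists f, g, (uval (- int_comb a en)); split=> //; rewrite ?gE ?uval_neq0 //.
  by rewrite -uvalD add0r addrN.
by rewrite fE -uvalD eE addrA.
Qed.

Lemma semifield_adjoin_frac (D : comNzSemiRingType) (F : set D) n
    (a : 'I_n -> unit_pair D) :
    semifield [set: D] -> bipotent [set: D] -> semifield F ->
  semifield (adjoin_frac F (@uval D \o a)).
Proof.
move=> Dsf Dbip Fsf; have [F0 FB] := semifield_subgroup Fsf.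
apply: semifieldP => //.
  by apply: adjoin_frac0; [exact: semifield0 | exact: F0].
split=> [|x y /units_in_adjoin_frac xP /units_in_adjoin_frac yP].
  by apply/units_in_adjoin_frac => //; exists 0, (fun=> 0); rewrite int_comb0 addr0.
have [//|//|//|v [e [Fv ->]]] := xP.
have [//|//|//|w [f [Fw ->]]] := yP.
apply/units_in_adjoin_frac => //; exists (v - w), (fun i => e i - f i).
by split; [exact: FB | rewrite -int_combB opprD addrACA].
Qed.

(** Two monomials agreeing at [b] make [b ^ (e1 - e2)] an element of [F^*]; when
    the exponents coincide, cancellation identifies the coefficients. *)
Lemma divisibly_free_of_independent (D : comNzSemiRingType) (F : set D) n
    (b : 'I_n -> unit_pair D) :
    semifield [set: D] -> semifield F ->
    (forall e, units_in F (int_comb b e) -> forall i, e i = 0) ->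
  divisibly_free F (@uval D \o b).
Proof.
move=> Dsf Fsf indep; have Fgrp := semifield_subgroup Fsf.
split=> [i|[m1 [m2 [mon1 mon2 m12]]]].
  by exists (uval (- b i)); rewrite -uvalD addrN.
have monE (m : mvpoly D n) : monomial_over F m -> exists w e,
    [/\ units_in F w, m = term_poly (uval w) e
      & mveval (@uval D \o b) m = uval (w + int_comb b (fun i => (e i)%:Z))].
  case=> Fm /eqP/cardfs1P[e mE].
  have me0 : m e != 0 by rewrite -mem_finsupp mE inE.
  have [w wE] := semifield_unit Dsf I me0.
  have mT : m = term_poly (uval w) e.
    apply/fsfunP => e'; rewrite term_polyE wE; have [->//|ee'] := eqVneq.
    by apply: fsfun_dflt; rewrite mE inE.
  exists w, e; split=> //; first by rewrite /units_in /= wE; apply: Fm.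
  by rewrite mT mveval_term uvalD uval_int_comb.
have [w1 [e1 [Fw1 m1E ->]]] := monE _ mon1.
have [w2 [e2 [Fw2 m2E ->]]] := monE _ mon2.
move=> /uval_inj eqs.
have diff : int_comb b (fun i => (e1 i)%:Z - (e2 i)%:Z) = w2 - w1.
  by rewrite -int_combB -[in LHS](addKr w1 (int_comb b _)) eqs addrA addrK addrC.
have e12 : e1 = e2.
  apply/ffunP => i; have Fd : units_in F (w2 - w1) by apply: (proj2 Fgrp).
  by move: Fd; rewrite -diff => /indep/(_ i)/eqP; rewrite subr_eq0 => /eqP[].
apply: m12; rewrite m1E m2E e12; move: eqs; rewrite e12 => /addIr ->.
by [].
Qed.

(** The generators that vanish are replaced by [1]: the monomials that contain
    them take no nonzero value. *)
Lemma affine_unit_generators (D : comNzSemiRingType) (H : set D) n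
    (a : 'I_n -> D) :
    semifield [set: D] -> bipotent [set: D] -> [set: D] = adjoin H a ->
  exists au : 'I_n -> unit_pair D, forall u, exists w (e : 'I_n -> nat),
    units_in H w /\ u = w + int_comb au e.
Proof.
move=> Dsf Dbip DE.
have /choice[au auE] : forall i, exists u : unit_pair D, a i != 0 -> uval u = a i.
  move=> i; have [->|ai] := eqVneq (a i) 0; first by exists 0.
  by have [u uE] := semifield_unit Dsf I ai; exists u.
exists au => u; have [f Hf fu] : adjoin H a (uval u) by rewrite -DE.
have [w [e [Hw uE]]] := mveval_unit Dsf Dbip Hf fu.
exists w, e; split=> //; apply: uval_inj; rewrite uE uvalD uval_int_comb.
congr (_ * _).
apply: eq_bigr => i _; have [->//|ei] := eqVneq (e i) 0%N.
rewrite auE //; apply: contraNneq (uval_neq0 u) => ai.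
by rewrite uE (bigD1 i) //= ai expr0n (negPf ei) mul0r mulr0.
Qed.

Lemma subset_of_units_in (D : comNzSemiRingType) (F G : set D) :
    semifield [set: D] -> G 0 -> units_in F `<=` units_in G -> F `<=` G.
Proof.
move=> Dsf G0 FG x; have [->//|x0] := eqVneq x 0.
by have [u <-] := semifield_unit Dsf I x0; apply: FG.
Qed.

Unset Implicit Arguments.

(** * The decomposition *)

Theorem theorem3p30 (D : comNzSemiRingType) (H : set D)
    (n : nat) (a : 'I_n -> D)
    (H_semifield : semifield H)
    (D_semifield : semifield [set: D])
    (D_bipotent : bipotent [set: D])
    (D_affine : [set: D] = adjoin H a) :
  exists (t s : nat) (b : 'I_t -> D) (c : 'I_s -> D),
    [/\ (forall i, b i != 0) /\ (forall j, c j != 0),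
        [set: D] = adjoin (adjoin_frac H b) c,
        [set: D] = adjoin_frac (adjoin H c) b,
        semifield_extension H (adjoin_frac H b) /\ divisibly_free H b
      & semifield_extension H (adjoin H c) /\ torsion_over H (adjoin H c)].
Proof.
have Hgrp := semifield_subgroup H_semifield.
have H0 := semifield0 H_semifield.
pose T := isolator (units_in H).
have Tgrp : subgroup T := subgroup_isolator Hgrp.
have Tsat : saturated T := @saturated_isolator _ _.
have HT : units_in H `<=` T := @sub_isolator _ _.
have [au au_gen] := affine_unit_generators D_semifield D_bipotent D_affine.
have au_genT : generate_modulo T au.
  move=> u; have [w [e [Hw ->]]] := au_gen u.
  by exists (fun i => (e i)%:Z); rewrite addrK; apply: HT.
have [t [b [bgen bindep]]] := independent_generators Tgrp Tsat au_genT.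
have /choice[g Tg] := fun i => bgen (au i).
pose c i := au i - int_comb b (g i).
have Tcomb (e : 'I_n -> nat) : T (int_comb c e).
  rewrite /int_comb; apply: (@big_ind _ T) => [|x y|i _]; first exact: (proj1 Tgrp).
    exact: subgroup_add.
  by apply: subgroup_mulrz => //; apply: Tg.
have decomp u : exists w (e : 'I_n -> nat) f,
    units_in H w /\ u = w + int_comb c e + int_comb b f.
  have [w [e [Hw ->]]] := au_gen u.
  exists w, e, (fun j => \sum_i g i j * (e i)%:Z); split=> //.
  rewrite -addrA; congr (_ + _).
  have -> : int_comb b (fun j => \sum_i g i j * (e i)%:Z)
      = \sum_i int_comb b (g i) *~ (e i)%:Z.
    transitivity (\sum_j \sum_i b j *~ g i j *~ (e i)%:Z).
      by apply: eq_bigr => j _; rewrite mulrz_sumr; apply: eq_bigr => i _; rewrite mulrzA.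
    by rewrite exchange_big; apply: eq_bigr => i _; rewrite mulrz_suml.
  by rewrite -big_split; apply: eq_bigr => i _ /=; rewrite -mulrzDl subrK.
(* The [b]-part of a torsion unit is torsion, hence trivial by independence. *)
have cT : units_in (adjoin H (@uval D \o c)) = T.
  apply/seteqP; split=> [u|u Tu].
    case/units_in_adjoin => // w [e [Hw ->]].
    by apply: subgroup_add => //; apply: HT.
  apply/units_in_adjoin => //; have [w [e [f [Hw uE]]]] := decomp u.
  have Tf : T (int_comb b f).
    have -> : int_comb b f = u - (w + int_comb c e) by rewrite uE addrC addKr.
    by apply: (proj2 Tgrp) => //; apply: subgroup_add => //; apply: HT.
  exists w, e; split=> //; rewrite uE [X in _ + X]big1 ?addr0 // => i _.
  by rewrite bindep ?mulr0z.
have Hc0 : adjoin H (@uval D \o c) 0 by apply: adjoin0.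
have Hc_semifield : semifield (adjoin H (@uval D \o c)).
  by apply: semifieldP => //; rewrite cT.
have Hb_semifield : semifield (adjoin_frac H (@uval D \o b)).
  exact: semifield_adjoin_frac.
exists t, n, (@uval D \o b), (@uval D \o c); split.
- by split=> i; apply: uval_neq0.
- apply/seteqP; split=> // ; apply: subset_of_units_in => //.
    by apply: adjoin0; apply: semifield0.
  move=> u _; have [w [e [f [Hw ->]]]] := decomp u.
  apply/units_in_adjoin => //; first exact: semifield0.
  exists (w + int_comb b f), e; rewrite addrAC; split=> //.
  by apply/units_in_adjoin_frac => //; exists w, f.
- apply/seteqP; split=> // ; apply: subset_of_units_in => //.
    exact: (semifield0 (semifield_adjoin_frac _ _ _ _)).
  move=> u _; have [w [e [f [Hw ->]]]] := decomp u.
  apply/units_in_adjoin_frac => //; exists (w + int_comb c e), f; split=> //.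
  by apply/units_in_adjoin => //; exists w, e.
- split; last first.
    by apply: divisibly_free_of_independent => // e He; apply: bindep; apply: HT.
  split=> //; apply: subset_of_units_in => //; first exact: semifield0.
  move=> w Hw; apply/units_in_adjoin_frac => //.
  by exists w, (fun=> 0); rewrite int_comb0 addr0.
- split.
    by split=> //; apply: subset_of_units_in => //; rewrite cT.
  move=> x Hcx; have [->|x0] := eqVneq x 0; first by exists 1%N.
  have [u ux] := semifield_unit D_semifield I x0.
  have [k k0 Hk] : T u by rewrite -cT /units_in /= ux.
  by exists k => //; rewrite -ux -uvalMn.
Qed.
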